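(* For the distributed convolution problem of computing $\boldsymbol a*\boldsymbol b$ using $N$ workers that can each store a $\frac1m$ fraction of $\boldsymbol a$ and a $\frac1n$ fraction of $\boldsymbol b$, the optimum recovery threshold achievable using linear codes, $K^*_{\textup{conv-linear}}$, is $$K^*_{\textup{conv-linear}}=m+n-1.$$
   Context: Setting. $m,n,s,N$ are positive integers and $\mathbb F$ is a sufficiently large field, i.e. $|\mathbb F|\ge q_0$ for some threshold $q_0$ depending only on $m,n,N$. The inputs are vectors $\boldsymbol a=[\boldsymbol a_0\ \boldsymbol a_1\ \cdots\ \boldsymbol a_{m-1}]\in\mathbb F^{ms}$ and $\boldsymbol b=[\boldsymbol b_0\ \boldsymbol b_1\ \cdots\ \boldsymbol b_{n-1}]\in\mathbb F^{ns}$, where all $\boldsymbol a_i,\boldsymbol b_i$ are vectors of length $s$ over $\mathbb F$; $*$ denotes the usual (linear, i.e. polynomial-multiplication) convolution of vectors. Each worker $i\in\{0,\dots,N-1\}$ stores two vectors of length $s$, $f_i(\boldsymbol a)$ and $g_i(\boldsymbol b)$, given by encoding functions $f_i:\mathbb F^{ms}\to\mathbb F^s$ and $g_i:\mathbb F^{ns}\to\mathbb F^s$, and returns the convolution $f_i(\boldsymbol a)*g_i(\boldsymbol b)$ to the master. The recovery threshold $K(\boldsymbol f,\boldsymbol g)$ of the encoding functions is the minimum integer $k$ such that for every subset of $k$ workers there is a decoding function recovering $\boldsymbol a*\boldsymbol b$, for all inputs $\boldsymbol a,\boldsymbol b$, from the results of those $k$ workers. $K^*_{\textup{conv-linear}}$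 is the minimum of $K(\boldsymbol f,\boldsymbol g)$ over all encoding functions in which every $f_i$ and $g_i$ is $\mathbb F$-linear (decoding functions are arbitrary). Standing assumption: $N$ is large enough that at least one valid computation strategy with linear encoding functions exists (i.e. $\boldsymbol a*\boldsymbol b$ can be recovered from the results of all $N$ workers). *)

(* Defs.v *)
From mathcomp Require Import all_boot all_order all_algebra.

Set Implicit Arguments.
Unset Strict Implicit.
Unset Printing Implicit Defensive.

Import GRing.Theory.
Local Open Scope ring_scope.

(* |F| >= q, for a field F that may be finite or infinite. *)
Definition card_ge (F : fieldType) (q : nat) : Prop :=
  exists x : 'I_q -> F, injective x.

Definition conv (F : fieldType) (p q : nat) (u : 'rV[F]_p) (v : 'rV[F]_q) :
    'rV[F]_(p + q - 1) :=
  \row_(k < (p + q - 1)%N)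
    \sum_(i < p) \sum_(j < q | (i + j)%N == k) u 0 i * v 0 j.

(* A vector [a_0 ... a_{m-1}] made of m blocks of length s is a row vector of
   length m * s; worker i stores the length-s vector f i a. *)
Definition encoding (F : fieldType) (N m s : nat) : Type :=
  'I_N -> 'rV[F]_(m * s) -> 'rV[F]_s.

Definition linear_encoding (F : fieldType) (N m s : nat)
    (f : encoding F N m s) : Prop :=
  forall i, linear (f i).

Definition results (F : fieldType) (N m n s : nat)
    (f : encoding F N m s) (g : encoding F N n s) (S : {set 'I_N})
    (a : 'rV[F]_(m * s)) (b : 'rV[F]_(n * s)) :
    {ffun {i | i \in S} -> 'rV[F]_(s + s - 1)} :=
  [ffun i => conv (f (val i) a) (g (val i) b)].

Definition decodable (F : fieldType) (N m n s : nat)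
    (f : encoding F N m s) (g : encoding F N n s) (S : {set 'I_N}) : Prop :=
  exists d : {ffun {i | i \in S} -> 'rV[F]_(s + s - 1)} ->
             'rV[F]_(m * s + n * s - 1),
    forall a b, d (results f g S a b) = conv a b.

Definition is_minimum (P : nat -> Prop) (k : nat) : Prop :=
  P k /\ forall j, P j -> (k <= j)%N.

(* The bound k <= N excludes the values k > N, for which the condition on
   subsets of size k holds vacuously.  A pair (f, g) that cannot be decoded
   even from all N workers has no recovery threshold. *)
Definition is_recovery_threshold (F : fieldType) (N m n s : nat)
    (f : encoding F N m s) (g : encoding F N n s) : nat -> Prop :=
  is_minimum (fun k => (k <= N)%N /\
    forall S : {set 'I_N}, #|S| = k -> decodable f g S).

Definition is_K_conv_linear (F : fieldType) (N m n s : nat) : nat -> Prop :=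
  is_minimum (fun K => exists (f : encoding F N m s) (g : encoding F N n s),
    [/\ linear_encoding f, linear_encoding g & is_recovery_threshold f g K]).

Definition linear_feasible (F : fieldType) (N m n s : nat) : Prop :=
  exists (f : encoding F N m s) (g : encoding F N n s),
    [/\ linear_encoding f, linear_encoding g & decodable f g [set: 'I_N]].

(* Main.v *)
From HB Require Import structures.
Require Import Defs.
From mathcomp Require Import all_boot all_order all_algebra.
From Stdlib Require Import Classical IndefiniteDescription.

(** Converse: if [|S| < m + n - 1], split [S] into a part with fewer than [m]
    workers and a part with fewer than [n] workers.  By counting dimensions,
    some [a <> 0] is encoded to [0] by the first part and some [b <> 0] by the
    second.  All results for [(a, b)] then vanish, as they do for [(0, 0)], but
    [a * b <> 0] because polynomials form an integral domain.

    Achievability: view [a] as [A(X, Y) = \sum_j a_j(X) Y^j], so that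
    [a(X) = A(X, X^s)], and likewise [b].  Worker [i] stores [A(X, x_i)] and
    [B(X, x_i)] for distinct scalars [x_i] and returns [(AB)(X, x_i)].  Since [AB]
    has degree at most [m + n - 2] in [Y], any [m + n - 1] results determine it,
    hence also [(AB)(X, X^s) = a(X) b(X)]. *)

Set Implicit Arguments.
Unset Strict Implicit.
Unset Printing Implicit Defensive.

Import GRing.Theory.
Local Open Scope ring_scope.

Lemma exists_subset_card (T : finType) (S : {set T}) (k : nat) :
  (k <= #|S|)%N -> exists2 A : {set T}, A \subset S & #|A| = k.
Proof.
case/card_geqP => r [r_uniq r_size rS]; exists [set x in r].
  by apply/subsetP => x; rewrite inE => /rS.
by rewrite cardsE (card_uniqP r_uniq).
Qed.

(** * Convolution as multiplication of polynomials *)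

Lemma rVpolyE (R : nzRingType) (p : nat) (u : 'rV[R]_p) :
  rVpoly u = \sum_(i < p) u 0 i *: 'X^i.
Proof. by rewrite /rVpoly poly_def; apply: eq_bigr => i _; rewrite valK. Qed.

Lemma rVpoly_conv (F : fieldType) (p q : nat) (u : 'rV[F]_p) (v : 'rV[F]_q) :
  rVpoly (conv u v) = rVpoly u * rVpoly v.
Proof.
have -> : rVpoly u * rVpoly v =
    \sum_(i < p) \sum_(j < q) (u 0 i * v 0 j) *: 'X^(i + j).
  rewrite !rVpolyE mulr_suml; apply: eq_bigr => i _.
  rewrite mulr_sumr; apply: eq_bigr => j _.
  by rewrite -scalerAl -scalerAr scalerA exprD.
apply/polyP => k.
rewrite coef_sum coef_rVpoly.
have -> : \sum_(i < p) (\sum_(j < q) (u 0 i * v 0 j) *: 'X^(i + j))`_k =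
    \sum_(i < p) \sum_(j < q | (i + j)%N == k) u 0 i * v 0 j.
  apply: eq_bigr => i _; rewrite coef_sum [RHS]big_mkcond.
  apply: eq_bigr => j _; rewrite coefZ coefXn eq_sym.
  by case: eqP; rewrite ?mulr1 ?mulr0.
case: insubP => [l _ <- | le_pq_k]; first by rewrite mxE.
(* Here [k] is at least [p + q - 1], which no sum [i + j] with [i < p] and [j < q] reaches. *)
rewrite big1 // => i _; rewrite big1 // => j /eqP ij_k.
case/negP: le_pq_k; rewrite -ij_k.
by rewrite ltn_subRL add1n -addSn -addnS leq_add.
Qed.

Lemma rVpoly_inj (F : fieldType) (p : nat) : injective (@rVpoly F p).
Proof. exact: can_inj rVpolyK. Qed.

Lemma rVpoly_eq0 (F : fieldType) (p : nat) (u : 'rV[F]_p) :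
  (rVpoly u == 0) = (u == 0).
Proof. by rewrite -(inj_eq (@rVpoly_inj F p)) linear0. Qed.

Lemma conv0r (F : fieldType) (p q : nat) (u : 'rV[F]_p) :
  conv u (0 : 'rV[F]_q) = 0.
Proof. by apply: rVpoly_inj; rewrite rVpoly_conv !linear0 mulr0. Qed.

Lemma conv0l (F : fieldType) (p q : nat) (v : 'rV[F]_q) :
  conv (0 : 'rV[F]_p) v = 0.
Proof. by apply: rVpoly_inj; rewrite rVpoly_conv !linear0 mul0r. Qed.

Lemma conv_eq0 (F : fieldType) (p q : nat) (u : 'rV[F]_p) (v : 'rV[F]_q) :
  (conv u v == 0) = (u == 0) || (v == 0).
Proof. by rewrite -rVpoly_eq0 rVpoly_conv mulf_eq0 !rVpoly_eq0. Qed.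

(** * Lower bound by counting dimensions *)

Lemma linear_ltn_ker (F : fieldType) (p q : nat) (h : 'rV[F]_p -> 'rV[F]_q) :
  linear h -> (q < p)%N -> exists2 u, u != 0 & h u = 0.
Proof.
move=> h_lin lt_qp.
pose hL : {linear 'rV[F]_p -> 'rV[F]_q} :=
  HB.pack h (GRing.isLinear.Build _ _ _ _ h h_lin).
have /rowV0Pn [u /sub_kermxP u_ker u_neq0] : kermx (lin1_mx hL) != 0.
  rewrite kermx_eq0 -row_leq_rank -ltnNge.
  exact: leq_ltn_trans (rank_leq_col _) lt_qp.
by exists u => //; rewrite mul_rV_lin1 in u_ker.
Qed.

Lemma linear_encoding_ker (F : fieldType) (N m s : nat)
    (f : encoding F N m s) (A : {set 'I_N}) :
  linear_encoding f -> (0 < s)%N -> (#|A| < m)%N ->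
  exists2 a, a != 0 & forall i, i \in A -> f i a = 0.
Proof.
move=> f_lin s_gt0 ltAm.
(* Concatenating what the workers of [A] store gives one linear map into dimension
   [#|A| * s < m * s]. *)
pose h a : 'rV[F]_(#|A| * s) :=
  mxvec (\matrix_(i < #|A|) f (enum_val i) a).
have h_lin : linear h.
  move=> c a a'; rewrite /h -linearP; congr mxvec.
  by apply/matrixP => i j; rewrite !mxE f_lin !mxE.
have [|a a_neq0 ha0] := linear_ltn_ker h_lin; first by rewrite ltn_pmul2r.
exists a => // i iA.
move/(congr1 vec_mx): ha0; rewrite mxvecK linear0.
move/(congr1 (row (enum_rank_in iA i))).
by rewrite rowK enum_rankK_in // linear0.
Qed.

Lemma decodable_card (F : fieldType) (N m n s : nat)
    (f : encoding F N m s) (g : encoding F N n s) (S : {set 'I_N}) :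
  (0 < m)%N -> (0 < n)%N -> (0 < s)%N ->
  linear_encoding f -> linear_encoding g -> decodable f g S ->
  (m + n - 1 <= #|S|)%N.
Proof.
move=> m_gt0 n_gt0 s_gt0 f_lin g_lin [d dP]; rewrite leqNgt; apply/negP => ltS.
(* [A] is as large as possible below [m]; if [S] has fewer than [m.-1] workers, then [A] is all of
   [S] and the other part is empty. *)
have [A AS cardA] : exists2 A : {set 'I_N}, A \subset S & #|A| = minn m.-1 #|S|.
  exact/exists_subset_card/geq_minr.
have ltAm : (#|A| < m)%N by rewrite cardA -(prednK m_gt0) ltnS geq_minl.
have ltBn : (#|S :\: A| < n)%N.
  rewrite cardsD (setIidPr AS) cardA.
  case: (leqP m.-1 #|S|) => [le_mS | _]; last by rewrite subnn.
  by rewrite ltn_subLR //; case: (m) m_gt0 ltS => // k _; rewrite addSn subn1.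
have [a a_neq0 fa0] := linear_encoding_ker f_lin s_gt0 ltAm.
have [b b_neq0 gb0] := linear_encoding_ker g_lin s_gt0 ltBn.
(* Comparing with [(a, 0)] suffices: its results and its convolution vanish as well. *)
have := dP a b; have := dP a 0.
have -> : results f g S a 0 = results f g S a b.
  apply/ffunP => -[i iS]; rewrite !ffunE /=.
  have [iA | iNA] := boolP (i \in A); first by rewrite fa0 // !conv0l.
  rewrite gb0 ?inE ?iNA //; congr conv.
  by have := g_lin i (-1) 0 0; rewrite scaler0 addr0 scaleN1r addNr.
move=> -> /esym/eqP; rewrite conv0r conv_eq0.
by rewrite (negPf a_neq0) (negPf b_neq0).
Qed.

(** * Upper bound by evaluation and interpolation *)

Lemma decodable_of_results_determine (F : fieldType) (N m n s : nat)
    (f : encoding F N m s) (g : encoding F N n s) (S : {set 'I_N}) :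
  (forall a b a' b', results f g S a b = results f g S a' b' ->
     conv a b = conv a' b') ->
  decodable f g S.
Proof.
move=> inj_fg.
have [|d dP] := functional_choice
  (fun r c => forall a b, results f g S a b = r -> conv a b = c).
  move=> r.
  have [[a [b <-]] | no_ab] :=
    classic (exists a b, results f g S a b = r).
    by exists (conv a b) => a' b' /inj_fg.
  (* Default value on tuples that no input produces. *)
  by exists 0 => a b ab_r; case: no_ab; exists a, b.
by exists d => a b; rewrite -(dP _ a b erefl).
Qed.

(* [A(X, Y)], as a polynomial in [Y] with coefficients in [F[X]]. *)
Definition blockpoly (F : fieldType) (m s : nat) (a : 'rV[F]_(m * s)) :
    {poly {poly F}} :=
  \poly_(j < m) take_poly s (drop_poly (j * s) (rVpoly a)).

(** Keeping the remainder term lets the induction on [m] cut off one more block at each step; it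
    vanishes once [p] has size at most [m * s]. *)
Lemma sum_take_drop_poly (R : nzRingType) (m s : nat) (p : {poly R}) :
  \sum_(j < m) take_poly s (drop_poly (j * s) p) * 'X^(j * s) +
    drop_poly (m * s) p * 'X^(m * s) = p.
Proof.
elim: m => [|m IHm]; first by rewrite big_ord0 add0r drop_poly0l mulr1.
rewrite big_ord_recr /= -[RHS]IHm -addrA; congr (_ + _).
rewrite -[drop_poly (m * s) p in RHS](poly_take_drop s) mulrDl; congr (_ + _).
rewrite -mulrA -exprD -mulSn; congr (_ * _).
by apply/polyP => k; rewrite !coef_drop_poly mulSn addnA.
Qed.

Lemma blockpoly_Xn (F : fieldType) (m s : nat) (a : 'rV[F]_(m * s)) :
  (blockpoly a).['X^s] = rVpoly a.
Proof.
rewrite horner_poly -[RHS](sum_take_drop_poly m s).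
rewrite (@drop_poly_eq0 _ (m * s)) ?size_poly // mul0r addr0.
by apply: eq_bigr => j _; rewrite -exprM mulnC.
Qed.

Lemma blockpoly_linear (F : fieldType) (m s : nat) (c : F)
    (a a' : 'rV[F]_(m * s)) :
  blockpoly (c *: a + a') = c%:P *: blockpoly a + blockpoly a'.
Proof.
apply/polyP => j; rewrite coefD coefZ !coef_poly.
case: ifP => _; last by rewrite mulr0 addr0.
by rewrite linearP /= drop_polyD take_polyD drop_polyZ take_polyZ mul_polyC.
Qed.

Definition poly_encoding (F : fieldType) (N m s : nat) (x : 'I_N -> F) :
    encoding F N m s :=
  fun i a => poly_rV (blockpoly a).[(x i)%:P].

Lemma poly_encoding_linear (F : fieldType) (N m s : nat) (x : 'I_N -> F) :
  linear_encoding (@poly_encoding F N m s x).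
Proof.
move=> i c a a'; rewrite /poly_encoding blockpoly_linear.
by rewrite hornerD hornerZ mul_polyC linearP.
Qed.

(** Evaluating at a constant only combines blocks of size at most [s] with scalars, so [poly_rV]
    truncates nothing. *)
Lemma rVpoly_poly_encoding (F : fieldType) (N m s : nat) (x : 'I_N -> F) i
    (a : 'rV[F]_(m * s)) :
  rVpoly (poly_encoding x i a) = (blockpoly a).[(x i)%:P].
Proof.
apply: poly_rV_K; rewrite horner_poly.
apply: (leq_trans (size_sum _ _ _)); apply/bigmax_leqP => j _.
rewrite -rmorphXn /= mulrC mul_polyC.
exact: leq_trans (size_scale_leq _ _) (size_take_poly _ _).
Qed.

(** A nonzero [p - q] would have more roots than its size allows. An integral domain is enough, so
    this applies with coefficients in [F[X]]. *)
Lemma eq_poly_roots (R : idomainType) (p q : {poly R}) (r : seq R) :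
  (size p <= size r)%N -> (size q <= size r)%N -> uniq r ->
  {in r, forall x, p.[x] = q.[x]} -> p = q.
Proof.
move=> size_p size_q r_uniq pq; apply/eqP; rewrite -subr_eq0.
apply: contraT => /max_poly_roots /(_ _ r_uniq) lt_r.
have: (size r < size (p - q)%R)%N.
  apply: lt_r; apply/allP => x xr.
  by rewrite /root hornerD hornerN pq // subrr.
by rewrite ltnNge (leq_trans (size_polyD _ _)) // size_polyN geq_max size_p.
Qed.

Lemma size_blockpolyM (F : fieldType) (m n s : nat)
    (a : 'rV[F]_(m * s)) (b : 'rV[F]_(n * s)) :
  (size (blockpoly a * blockpoly b)%R <= m + n - 1)%N.
Proof.
apply: leq_trans (size_polyMleq _ _) _.
by rewrite -subn1 leq_sub2r // leq_add // size_poly.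
Qed.

Lemma poly_encoding_decodable (F : fieldType) (N m n s : nat) (x : 'I_N -> F)
    (S : {set 'I_N}) :
  injective x -> (m + n - 1 <= #|S|)%N ->
  decodable (@poly_encoding F N m s x) (@poly_encoding F N n s x) S.
Proof.
move=> x_inj leS; apply: decodable_of_results_determine => a b a' b' eq_res.
(* The product in two variables determines the convolution through the substitution of ['X^s] for
   [Y]. *)
suff eqM : blockpoly a * blockpoly b = blockpoly a' * blockpoly b'.
  by apply: rVpoly_inj; rewrite !rVpoly_conv -!blockpoly_Xn -!hornerM eqM.
apply: (@eq_poly_roots _ _ _ [seq (x i)%:P | i <- enum S]).
- by rewrite size_map -cardE (leq_trans (size_blockpolyM _ _)).
- by rewrite size_map -cardE (leq_trans (size_blockpolyM _ _)).
- by rewrite map_inj_uniq ?enum_uniq // => i j /polyC_inj /x_inj.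
move=> y /mapP [i]; rewrite mem_enum => iS ->.
move/ffunP/(_ (exist _ i iS)): eq_res; rewrite !ffunE /= => /(congr1 rVpoly).
by rewrite !rVpoly_conv !rVpoly_poly_encoding !hornerM.
Qed.

Theorem theorem4 (m n N : nat) (hm : (0 < m)%N) (hn : (0 < n)%N)
    (hN : (0 < N)%N) :
  exists q0 : nat, forall (F : fieldType) (s : nat),
    card_ge F q0 -> (0 < s)%N -> linear_feasible F N m n s ->
    is_K_conv_linear F N m n s (m + n - 1)%N.
Proof.
(* One distinct evaluation point per worker requires [N] elements of [F]. *)
exists N => F s [x x_inj] s_gt0 [f0 [g0 [f0_lin g0_lin dec0]]].
(* Feasibility enters here, through the converse for the set of all workers. *)
have le_KN : (m + n - 1 <= N)%N.
  have := decodable_card hm hn s_gt0 f0_lin g0_lin dec0.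
  by rewrite cardsT card_ord.
(* Since [j <= N], some set of exactly [j] workers exists, and the converse applies to it. This
   serves both minimality claims. *)
have lower f g j : @linear_encoding F N m s f -> @linear_encoding F N n s g ->
    (j <= N)%N -> (forall S : {set 'I_N}, #|S| = j -> decodable f g S) ->
    (m + n - 1 <= j)%N.
  move=> f_lin g_lin le_jN dec.
  have [|S _ cardS] := @exists_subset_card _ [set: 'I_N] j.
    by rewrite cardsT card_ord.
  by rewrite -cardS; apply: decodable_card (dec S cardS).
split=> [|K [f [g [f_lin g_lin [[le_KN' dec] _]]]]]; last exact: lower dec.
exists (poly_encoding x), (poly_encoding x).
split; try exact: poly_encoding_linear.
split=> [|j [le_jN dec]].
  by split=> // S cardS; apply: poly_encoding_decodable; rewrite ?cardS.
by apply: lower dec => //; apply: poly_encoding_linear.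
Qed.
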